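(* Let $n$ be an integer with $3\le n\le 6$, let $G$ be a $1$-tough graph on $n$ vertices, and let $x,y\in V(G)$ be distinct nonadjacent vertices with $d(x)+d(y)\ge n-1$. If $G+xy$ is Hamiltonian, then $G$ is Hamiltonian.
   Context: All graphs are finite and simple. $d(v)$ is the degree of $v$ in $G$. For distinct nonadjacent vertices $x,y$ of $G$, $G+xy$ is the graph obtained from $G$ by adding the edge $xy$. A graph is Hamiltonian if it has a cycle through all its vertices. $c(H)$ denotes the number of connected components of a graph $H$. The toughness $\tau(G)$ of a non-complete graph $G$ is $\min\{|S|/c(G-S) : S\subseteq V(G),\ c(G-S)\ge 2\}$, and $\tau(G)=\infty$ if $G$ is complete. $G$ is $1$-tough if $\tau(G)\ge 1$. *)

(* Defs.v *)
From mathcomp Require Import all_boot all_order all_algebra.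
From mathcomp Require Import constructive_ereal.

Set Implicit Arguments.
Unset Strict Implicit.
Unset Printing Implicit Defensive.

Import Order.TTheory GRing.Theory Num.Theory.

Record sgraph (V : finType) := SGraph {
  adj :> rel V;
  adj_sym : symmetric adj;
  adj_irr : irreflexive adj
}.

Definition degree (V : finType) (G : sgraph V) (v : V) : nat := #|adj G v|.

(* The test [u != v] only matters when [x = y], in which case the graph is
   left unchanged; it makes the operation total. *)
Definition add_edge_rel (V : finType) (G : sgraph V) (x y : V) : rel V :=
  [rel u v | G u v || (u != v) && ([set u; v] == [set x; y])].

Lemma add_edge_sym (V : finType) (G : sgraph V) (x y : V) :
  symmetric (add_edge_rel G x y).
Proof. by move=> u v; rewrite /add_edge_rel /= (adj_sym G u v) (eq_sym u) setUC. Qed.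

Lemma add_edge_irr (V : finType) (G : sgraph V) (x y : V) :
  irreflexive (add_edge_rel G x y).
Proof. by move=> u; rewrite /add_edge_rel /= (adj_irr G u) eqxx. Qed.

Definition add_edge (V : finType) (G : sgraph V) (x y : V) : sgraph V :=
  SGraph (add_edge_sym G x y) (add_edge_irr G x y).

Definition del_rel (V : finType) (G : sgraph V) (S : {set V}) :
    rel {v : V | v \notin S} :=
  [rel u v | G (val u) (val v)].

Lemma del_sym (V : finType) (G : sgraph V) (S : {set V}) :
  symmetric (@del_rel V G S).
Proof. by move=> u v; exact: adj_sym. Qed.

Lemma del_irr (V : finType) (G : sgraph V) (S : {set V}) :
  irreflexive (@del_rel V G S).
Proof. by move=> u; exact: adj_irr. Qed.

Definition del_vertices (V : finType) (G : sgraph V) (S : {set V}) :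
    sgraph {v : V | v \notin S} :=
  SGraph (@del_sym V G S) (@del_irr V G S).

Definition num_components (V : finType) (G : sgraph V) : nat :=
  n_comp (adj G) V.

Definition complete (V : finType) (G : sgraph V) : bool :=
  [forall u, forall v, (u != v) ==> G u v].

(* When [G] is not complete, the minimum ranges over a nonempty family: deleting
   all vertices except two nonadjacent ones leaves two components.  Hence the
   default value [+oo] of the iterated minimum plays no role there. *)
Definition toughness (V : finType) (G : sgraph V) : \bar rat :=
  if complete G then +oo%E
  else \big[Order.min/+oo%E]_(S : {set V} |
              2 <= num_components (del_vertices G S))
         (#|S|%:R / (num_components (del_vertices G S))%:R)%R%:E.

Definition one_tough (V : finType) (G : sgraph V) : Prop :=
  (1 <= toughness G)%E.

(* A Hamiltonian cycle, listed as a duplicate-free cyclic sequence; the bound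
   on the size excludes the degenerate cycles on at most two vertices. *)
Definition hamiltonian (V : finType) (G : sgraph V) : Prop :=
  exists c : seq V, [/\ ucycle G c, 3 <= size c & forall v : V, v \in c].

(* Main.v *)
Require Import Defs.
From mathcomp Require Import all_boot all_order all_algebra.
From mathcomp Require Import constructive_ereal.

Import Order.TTheory GRing.Theory Num.Theory.

(* If G + xy has a Hamiltonian cycle and G has none, then G has a Hamiltonian
   path v_0, ..., v_m from one of x, y to the other, with m = n - 1.  An index i
   with both v_0 v_(i+1) and v_i v_m in G would close the path into a Hamiltonian
   cycle; since d(v_0) + d(v_m) >= m, exactly one of these edges is present for
   every i < m.  Hence the neighbourhood of v_0 determines that of v_m, and for
   n <= 6 every such adjacency pattern has either an explicit Hamiltonian cycle
   or an explicit set S with more than |S| components in its complement. *)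

(** A map constant along edges takes the same value at a vertex and at the root of its component, so
    the roots already hit every value. *)
Lemma leq_num_components (V I : finType) (G : sgraph V) (f : V -> I) :
    (forall u v, G u v -> f u = f v) -> (forall i, exists v, f v = i) ->
  #|I| <= num_components G.
Proof.
move=> f_adj f_surj.
have f_root v : f (fingraph.root G v) = f v.
  have /(_ _ _ (connect_root G v)): forall u w, connect G u w -> f u = f w.
    move=> u w /connectP[p Gp ->]; elim: p u Gp => //= z p IHp u /andP[uz /IHp <-].
    exact: f_adj.
  by move=> ->.
rewrite -[#|I|]cardsT; apply: leq_trans (leq_imset_card f _).
apply/subset_leq_card/subsetP=> i _; have [v <-] := f_surj i.
rewrite -f_root imset_f // inE andbT.
exact/roots_root/sym_connect_sym/adj_sym.
Qed.

Lemma one_tough_coloring (V : finType) (G : sgraph V) (f : V -> nat) (k : nat) :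
    one_tough G -> 1 < k ->
    (forall u v, G u v -> [|| f u == 0, f v == 0 | f u == f v]) ->
    (forall i, 0 < i <= k -> exists v, f v = i) ->
  k <= #|[set v | f v == 0]|.
Proof.
move=> Gtough k_gt1 f_adj f_surj; set S := [set v | f v == 0].
case: k => // k in k_gt1 f_surj *.
have k_comp : k.+1 <= num_components (del_vertices G S).
  pose g (w : {v | v \notin S}) : 'I_k.+1 := inord (f (val w)).-1.
  rewrite -[k.+1]card_ord; apply: (@leq_num_components _ _ _ g).
    move=> [u uS] [v vS] /= /f_adj; rewrite /g /=; move: uS vS.
    by rewrite !inE => /negPf-> /negPf-> /eqP->.
  move=> i; have [v fv] := f_surj i.+1 (ltn_ord i).
  have vS : v \notin S by rewrite inE fv.
  by exists (Sub v vS); rewrite /g /= fv inord_val.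
have comp_gt1 := leq_trans k_gt1 k_comp.
apply: leq_trans k_comp _; rewrite leqNgt; apply/negP => S_lt.
move: Gtough; rewrite /one_tough /toughness; case: ifP => [/forallP Gcomplete _|_].
  (* Infinite toughness gives no bound here; instead, vertices coloured [1] and [2] would be
     adjacent, against [f_adj]. *)
  have [u fu] := f_surj 1 isT; have [v fv] := f_surj 2 k_gt1.
  have uv : u != v by apply: contra_eq_neq fv => <-; rewrite fu.
  have /forallP/(_ v)/implyP/(_ uv)/f_adj := Gcomplete u.
  by rewrite fu fv.
move=> /le_trans/(_ (bigmin_le_cond _ _ comp_gt1)).
rewrite lee_fin ler_pdivlMr ?ltr0n ?(ltn_trans _ comp_gt1) // mul1r ler_nat.
by rewrite leqNgt S_lt.
Qed.

(** Vertices are named by their positions on the path, so explicit witnesses can be checked by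
    computation. *)
Definition ham_order (n : nat) (e : rel nat) (s : seq nat) : bool :=
  perm_eq s (iota 0 n) && cycle e s.

(* Colour [0] marks the deleted vertices; every edge between remaining vertices
   is monochromatic, so that each of the colours [1], ..., [k] accounts for at
   least one component. *)
Definition cut_coloring (n : nat) (e : rel nat) (k : nat) (c : seq nat) : bool :=
  [&& size c == n,
      pairwise (fun i j => [|| nth 0 c i == 0, nth 0 c j == 0,
                             nth 0 c i == nth 0 c j | ~~ e i j]) (iota 0 n),
      all (mem c) (iota 1 k) & maxn 1 (count_mem 0 c) < k].

(** The cycle follows [s], jumps to the end of [t], runs back to [z] and returns to [u]. *)
Lemma crossing_cycle (T : Type) (e : rel T) (u z : T) (s t : seq T) :
    symmetric e -> path e u (s ++ z :: t) -> e u z -> e (last u s) (last z t) ->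
  cycle e (u :: s ++ rev (z :: t)).
Proof.
move=> e_sym; rewrite cat_path => /and3P[us _ zt] uz st.
rewrite /= rcons_cat cat_path us -rev_cons lastI rev_rcons /= st.
rewrite -[u :: _]/(belast u (z :: t)) -[last z t]/(last u (z :: t)) rev_path.
by rewrite (@eq_path _ _ e) /= ?uz // => v w; exact: e_sym.
Qed.

Lemma ore_complement (n : nat) (e : rel nat) : symmetric e ->
    (forall i, i < n -> e i i.+1) ->
    n <= \sum_(i < n) e 0 i.+1 + \sum_(i < n) e i n ->
  (exists s, ham_order n.+1 e s) \/ (forall i, i < n -> e i n = ~~ e 0 i.+1).
Proof.
move=> e_sym e_path e_deg.
have [/existsP[i /andP[e0i ein]]|/existsPn e_cross] :=
  boolP [exists i : 'I_n, e 0 i.+1 && e i n]; [left | right].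
  have nE : n = i + (n - i.+1).+1 by rewrite -subSn // subnKC // ltnW.
  have iotaE : iota 1 n = iota 1 i ++ i.+1 :: iota i.+2 (n - i.+1).
    by rewrite {1}nE iotaD add1n.
  have last_iota1 j m : last j (iota j.+1 m) = j + m.
    by elim: m j => [|m IHm] j /=; rewrite ?addn0 // IHm addSnnS.
  exists (0 :: iota 1 i ++ rev (i.+1 :: iota i.+2 (n - i.+1))); apply/andP; split.
    by rewrite [iota 0 n.+1]/= iotaE perm_cons perm_cat2l perm_rev.
  apply: crossing_cycle; rewrite -?iotaE ?last_iota1 ?subnKC //.
  apply/(pathP 0) => j; rewrite size_iota => j_lt.
  by rewrite -[0 :: _]/(iota 0 n.+1) !nth_iota //; [exact: e_path | exact: ltnW].
(* Without a crossing each index contributes at most 1, with equality exactly when one of the two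
   edges is present; a total of at least [n] then forces equality at every index. *)
have e_le (i : 'I_n) : true -> e 0 i.+1 + e i n <= 1 ?= iff (e i n == ~~ e 0 i.+1).
  by move: (e_cross i); case: (e 0 _) (e i _) => [] [].
have := leqif_sum e_le; rewrite sum_nat_const card_ord muln1 big_split /=.
case=> le_n /esym; rewrite eqn_leq le_n e_deg => /forallP e_compl i i_lt.
exact/eqP/(e_compl (Ordinal i_lt)).
Qed.

(** Here [n] counts vertices, so the path ends at [n.-1]. Only the neighbours of [0] and a few inner
    chords remain to be split on. *)
Lemma ham_or_cut (n : nat) (e : rel nat) : 3 <= n <= 6 -> symmetric e ->
    (forall i, i.+1 < n -> e i i.+1) ->
    (forall i, i.+1 < n -> e i n.-1 = ~~ e 0 i.+1) ->
  (exists s, ham_order n e s) \/ (exists k c, cut_coloring n e k c).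
Proof.
move=> n36 e_sym e_path e_compl.
(* Ordering each pair lets a cycle be checked with facts [e i j] for [i < j] only. *)
have ham s : ham_order n (fun i j => e (minn i j) (maxn i j)) s ->
    (exists s, ham_order n e s) \/ (exists k c, cut_coloring n e k c).
  rewrite /ham_order (@eq_cycle _ _ e) => [s_ham|i j]; first by left; exists s.
  by rewrite /minn /maxn; case: ifP => // _; rewrite e_sym.
have cut k c : cut_coloring n e k c ->
    (exists s, ham_order n e s) \/ (exists k c, cut_coloring n e k c).
  by right; exists k, c.
case: n n36 => [|[|[|[|[|[|[|//]]]]]]] // _ in e_path e_compl ham cut *;
  rewrite /cut_coloring /ham_order /minn /maxn in ham cut;
  (* Index 0: since [e 0 1] holds, the two ends of the path are nonadjacent. *)
  have := e_compl 0 isT; rewrite (e_path 0 isT) /= => e0n.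
- by apply: (cut 2 [:: 1; 0; 2]); rewrite /= e0n.
- have /= := e_compl 1 isT; case e02: (e 0 2) => /= e13.
    by apply: (cut 2 [:: 1; 1; 0; 2]); rewrite /= e0n e13.
  by apply: (cut 2 [:: 1; 0; 2; 2]); rewrite /= e02 e0n.
- have /= := e_compl 1 isT; case e02: (e 0 2) => /= e14;
  have /= := e_compl 2 isT; case e03: (e 0 3) => /= e24.
  + by apply: (cut 2 [:: 1; 1; 1; 0; 2]); rewrite /= e0n e14 e24.
  + case e13: (e 1 3).
      by apply: (ham [:: 0; 1; 3; 4; 2]); rewrite /= !e_path // e13 e24 e02.
    by apply: (cut 2 [:: 1; 1; 0; 2; 2]); rewrite /= e0n e03 e13 e14.
  (* Deleting [1] and [3] isolates [0], [2] and [4]; this is the first cut with more than one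
     deleted vertex. *)
  + by apply: (cut 3 [:: 1; 0; 2; 0; 3]); rewrite /= e02 e0n e24.
  + by apply: (cut 2 [:: 1; 0; 2; 2; 2]); rewrite /= e02 e03 e0n.
(* The eight bullets run through [e 0 2], [e 0 3], [e 0 4], from all present to all absent. *)
- have /= := e_compl 1 isT; case e02: (e 0 2) => /= e15;
  have /= := e_compl 2 isT; case e03: (e 0 3) => /= e25;
  have /= := e_compl 3 isT; case e04: (e 0 4) => /= e35.
  + by apply: (cut 2 [:: 1; 1; 1; 1; 0; 2]); rewrite /= e0n e15 e25 e35.
  + case e14: (e 1 4).
      by apply: (ham [:: 0; 2; 1; 4; 5; 3]); rewrite /= !e_path // e02 e14 e35 e03.
    case e24: (e 2 4).
      by apply: (ham [:: 0; 1; 2; 4; 5; 3]); rewrite /= !e_path // e24 e35 e03.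
    by apply: (cut 2 [:: 1; 1; 1; 0; 2; 2]); rewrite /= e0n e04 e14 e15 e24 e25.
  + case e13: (e 1 3).
      by apply: (ham [:: 0; 1; 3; 4; 5; 2]); rewrite /= !e_path // e13 e25 e02.
    by apply: (cut 3 [:: 1; 1; 0; 2; 0; 3]); rewrite /= e0n e03 e13 e15 e35.
  + case e13: (e 1 3).
      by apply: (ham [:: 0; 1; 3; 4; 5; 2]); rewrite /= !e_path // e13 e25 e02.
    case e14: (e 1 4).
      by apply: (ham [:: 0; 1; 4; 3; 5; 2]); rewrite /= !e_path // e14 e35 e25 e02.
    by apply: (cut 2 [:: 1; 1; 0; 2; 2; 2]);
      rewrite /= e0n e03 e04 e13 e14 e15.
  + by apply: (ham [:: 1; 2; 3; 0; 4; 5]); rewrite /= !e_path // e03 e04 e15.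
  + case e24: (e 2 4).
      by apply: (ham [:: 0; 1; 5; 4; 2; 3]); rewrite /= !e_path // e15 e24 e03.
    by apply: (cut 3 [:: 1; 0; 2; 0; 3; 3]); rewrite /= e02 e0n e04 e24 e25.
  + by apply: (ham [:: 4; 3; 2; 5; 1; 0]); rewrite /= !e_path // e25 e15 e04.
  + by apply: (cut 2 [:: 1; 0; 2; 2; 2; 2]); rewrite /= e02 e03 e04 e0n.
Qed.

Lemma card_count (T : finType) (P : pred T) (p : seq T) :
  uniq p -> (forall v, v \in p) -> #|P| = count P p.
Proof.
move=> p_uniq p_all; rewrite -size_filter -(card_uniqP (filter_uniq _ p_uniq)).
by apply: eq_card => v; rewrite mem_filter p_all andbT.
Qed.

Lemma degree_nth (V : finType) (G : sgraph V) (w x0 : V) (p : seq V) :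
  uniq p -> (forall v, v \in p) -> degree G w = \sum_(i < size p) G w (nth x0 p i).
Proof.
move=> p_uniq p_all; rewrite /degree (card_count _ _ _ p_uniq p_all) -sum1_count.
rewrite big_mkcond (big_nth x0) big_mkord.
by apply: eq_bigr => i _; case: (G w _).
Qed.

(** Adjacency is transported to positions on the path. A Hamiltonian order maps back to a cycle of
    [G], while a cut colouring pulls back to one that contradicts toughness. *)
Lemma hamiltonian_of_path (V : finType) (G : sgraph V) (u : V) (s : seq V) :
    one_tough G -> path G u s -> uniq (u :: s) -> (forall v, v \in u :: s) ->
    2 <= size s <= 5 -> size s <= degree G u + degree G (last u s) ->
  hamiltonian G.
Proof.
move=> Gtough us_path us_uniq us_all s_size us_deg.
set p := u :: s in us_uniq us_all *; set n := size s in s_size us_deg *.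
pose e : rel nat := relpre (nth u p) G.
have e_sym : symmetric e by move=> i j; exact: adj_sym.
have e_path i : i < n -> e i i.+1 by move/pathP: us_path; exact.
have ham c : ham_order n.+1 e c -> hamiltonian G.
  case/andP=> c_perm c_cycle; exists (map (nth u p) c).
  have {}c_perm : perm_eq (map (nth u p) c) p.
    by have := perm_map (nth u p) c_perm; rewrite map_nth_iota0 // take_oversize.
  split; last by move=> v; rewrite (perm_mem c_perm).
    by rewrite /ucycle cycle_map c_cycle (perm_uniq c_perm).
  by rewrite (perm_size c_perm) ltnS; case/andP: s_size.
(* Each end has no loop, so its degree is a sum over the [n] other positions. *)
have e_deg : n <= \sum_(i < n) e 0 i.+1 + \sum_(i < n) e i n.
  have -> : \sum_(i < n) e 0 i.+1 = degree G u.
    by rewrite (degree_nth _ _ _ u _ us_uniq us_all) big_ord_recl /= adj_irr.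
  have -> : \sum_(i < n) e i n = degree G (last u s).
    rewrite (degree_nth _ _ _ u _ us_uniq us_all) big_ord_recr /= (last_nth u) adj_irr.
    by rewrite addn0; apply: eq_bigr => i _; rewrite e_sym.
  exact: us_deg.
have [[c]|e_compl] := ore_complement _ _ e_sym e_path e_deg; first exact: ham.
have [|[c]|[k [c /and4P[/eqP c_size c_adj c_surj c_cut]]]] :=
    ham_or_cut n.+1 e _ e_sym e_path e_compl; [by []|exact: ham|].
have /andP[k_gt1 c0_lt] : (1 < k) && (count_mem 0 c < k) by rewrite -gtn_max.
pose f v := nth 0 c (index v p).
have p_index v : index v p < n.+1 by rewrite index_mem us_all.
have nth_p v : nth u p (index v p) = v by rewrite nth_index.
have f_lt v w : index v p < index w p -> G v w ->
    [|| f v == 0, f w == 0 | f v == f w].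
  move=> vw Gvw; move/(pairwiseP 0): c_adj => /(_ (index v p) (index w p)).
  rewrite !inE size_iota => /(_ (p_index v) (p_index w) vw).
  by rewrite !nth_iota // /e /= !nth_p Gvw orbF.
(* The colouring only constrains pairs in increasing position; symmetry of [G] covers the rest. *)
have f_adj v w : G v w -> [|| f v == 0, f w == 0 | f v == f w].
  case: (ltngtP (index v p) (index w p)) => [|wv|vw] Gvw; first exact: f_lt.
    by rewrite orbCA (eq_sym (f v) (f w)) f_lt // adj_sym.
  by rewrite /f vw eqxx !orbT.
have f_surj i : 0 < i <= k -> exists v, f v = i.
  case/andP=> i_gt0 i_le; have /(allP c_surj) : i \in iota 1 k.
    by rewrite mem_iota i_gt0.
  rewrite /= => /(nthP 0)[j]; rewrite c_size => j_lt <-.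
  by exists (nth u p j); rewrite /f index_uniq.
have := one_tough_coloring _ _ _ _ Gtough k_gt1 f_adj f_surj.
rewrite leqNgt => /negP[]; apply: leq_ltn_trans c0_lt.
have -> : c = map f p.
  apply: (@eq_from_nth _ 0) => [|i]; rewrite c_size ?size_map // => i_lt.
  by rewrite (nth_map u) // /f index_uniq.
by rewrite count_map cardsE (card_count _ _ _ us_uniq us_all).
Qed.

(** The added edge has both ends in [[set x; y]], so it cannot avoid [w]. *)
Lemma add_edge_avoid (V : finType) (G : sgraph V) (x y w : V) :
  w \in [set x; y] -> {in predC1 w &, subrel (add_edge G x y) G}.
Proof.
move=> w_xy a b; rewrite !inE => aw bw /orP[//|/andP[_ /eqP ab]].
by move: w_xy; rewrite -ab !inE eq_sym (negPf aw) eq_sym (negPf bw).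
Qed.

Theorem theorem8 (n : nat) (hn : 3 <= n <= 6) (V : finType) (hV : #|V| = n)
    (G : sgraph V) (hG : one_tough G) (x y : V) (hxy : x != y)
    (hnadj : ~~ adj G x y) (hdeg : n - 1 <= degree G x + degree G y) :
  hamiltonian (add_edge G x y) -> hamiltonian G.
Proof.
case=> c [/andP[c_cycle c_uniq] c_size c_all].
have [c_G|] := boolP (cycle G c); first by exists c; rewrite /ucycle c_G.
(* Some step [u], [v] of the cycle is not in [G]; rotating [c] to start at [u] and dropping that
   step leaves the path [v], [t], [u]. *)
move=> c_nG; have [u uc uG] : exists2 u, u \in c & ~~ G u (next c u).
  apply/hasP; rewrite -[has _ _]negbK -all_predC; apply: contra c_nG => /allP c_next.
  by apply: cycle_from_next => // v /c_next /=; rewrite negbK.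
have [i [|v t] c_rot] := rot_to uc; have := size_rot i c; rewrite c_rot /=.
  by move=> c1; rewrite -c1 in c_size.
move=> size_t; have t_gt0 : 0 < size t by rewrite -size_t in c_size.
have vE : next c u = v by rewrite -(next_rot i c_uniq) c_rot /= eqxx.
rewrite vE in uG.
have := rot_cycle i (add_edge G x y) c; rewrite c_cycle c_rot /= => /andP[].
rewrite rcons_path => uv /andP[vt tu].
have := rot_uniq i c; rewrite c_uniq c_rot /= inE negb_or.
move=> /and3P[/andP[u'v ut] v't t_uniq].
have {uv} uv : [set u; v] = [set x; y].
  by case/orP: uv => [/(negP uG)//|/andP[_ /eqP]].
have G'_G w : w \in [set u; v] -> {in predC1 w &, subrel (add_edge G x y) G}.
  by rewrite uv; exact: add_edge_avoid.
have c_size_t : (size t).+2 = n.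
  rewrite size_t -hV -(card_uniqP c_uniq); apply: eq_card => w.
  by rewrite c_all.
apply: (@hamiltonian_of_path _ _ v (rcons t u)) => //=.
(* The stretch from [v] through [t] avoids [u], and the last edge avoids [v] because [t] is
   nonempty; so both lie in [G]. *)
- rewrite rcons_path; apply/andP; split.
    apply: (sub_in_path (G'_G u _)) vt; first by rewrite !inE eqxx.
    rewrite /= eq_sym u'v; apply/allP => w wt /=.
    by apply: contraNneq ut => <-.
  apply: (G'_G v) tu; rewrite !inE ?eqxx ?orbT //.
  apply: contraNneq v't => <-.
  by case: (t) t_gt0 => //= a t' _; rewrite mem_last.
- by rewrite mem_rcons inE negb_or eq_sym u'v v't rcons_uniq ut.
- move=> w; rewrite inE mem_rcons inE orbCA -!in_cons -c_rot mem_rot.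
  exact: c_all.
- by move: hn; rewrite -c_size_t size_rcons.
rewrite size_rcons last_rcons addnC; have -> : (size t).+1 = n - 1.
  by rewrite -c_size_t subn1.
(* Summing degrees over the set spares a case split on which of [u], [v] is [x]. *)
suff -> : degree G u + degree G v = degree G x + degree G y by [].
have sumE a b : a != b -> \sum_(w in [set a; b]) degree G w = degree G a + degree G b.
  by move=> ab; rewrite big_setU1 ?inE //= big_set1.
by rewrite -!sumE // uv.
Qed.
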